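(* Let $f,u\colon\mathbb{R}^n\to\mathbb{R}$ be directionally differentiable in the sense of Hadamard, let $\Omega=\{x\in\mathbb{R}^n\mid u(x)\le 0\}$ and let $x_\ast\in\Omega$. Suppose that the regularity condition $\operatorname{cl}\{K_{<}(x_\ast)\}=K_{\le}(x_\ast)$ holds at $x_\ast$. Let $E_{\ast}(f)$ and $E_{\ast}(u)$ be lower exhausters, in the sense of Hadamard, of $f$ and $u$ at $x_\ast$ respectively. If $x_\ast$ is a local minimum of $f$ on $\Omega$, then $$\bigcap_{C\in E_{\ast}(u)}\operatorname{cl}\left\{\mathbb{R}^n\setminus K^+(C)\right\}\subset \bigcup_{C\in E_{\ast}(f)}K^+(C).$$
   Context: A function $\varphi\colon\mathbb{R}^n\to\mathbb{R}$ is directionally differentiable in the sense of Hadamard at $x$ if for every $g\in\mathbb{R}^n$ the finite limit $\varphi'_H(x,g)=\lim_{[\alpha,g']\to[+0,g]}\frac{\varphi(x+\alpha g')-\varphi(x)}{\alpha}$ exists. A family $E_\ast(\varphi)$ of convex compact subsets of $\mathbb{R}^n$, totally bounded (i.e. all its members are contained in one common ball), is a lower exhauster of $\varphi$ at $x$ in the sense of Hadamard if $\varphi'_H(x,g)=\max_{C\in E_\ast(\varphi)}\min_{w\in C}\langle w,g\rangle$ for all $g\in\mathbb{R}^n$. The maxima over the families are attained. Members of the families are nonempty sets. For $x\in\mathbb{R}^n$, $K_{<}(x)=\{g\in\mathbb{R}^n\mid u'_H(x,g)<0\}$ and $K_{\le}(x)=\{g\in\mathbb{R}^n\mid u'_H(x,g)\le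 0\}$. For a convex compact set $C$, $K(C)=\operatorname{cone}\{C\}$ is the conic hull of $C$, and $K^+(C)=\{g\in\mathbb{R}^n\mid\langle v,g\rangle\ge 0\ \forall v\in K(C)\}$ is the conjugate cone of $K(C)$. $\operatorname{cl}$ denotes closure. *)

(* Defs.v *)
From HB Require Import structures.
From mathcomp Require Import all_boot all_order all_algebra.
From mathcomp Require Import all_classical all_reals all_analysis.

Set Implicit Arguments.
Unset Strict Implicit.
Unset Printing Implicit Defensive.

Import Order.TTheory GRing.Theory Num.Theory.
Import numFieldNormedType.Exports.

Local Open Scope classical_set_scope.
Local Open Scope ring_scope.

Definition dotp (R : realType) (n : nat) (v w : 'rV[R]_n) : R :=
  \sum_(i < n) v 0 i * w 0 i.

(* The library norm on 'rV[R]_n is the sup norm, hence an explicit ball. *)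
Definition euclidean_ball (R : realType) (n : nat) (c : 'rV[R]_n) (r : R) :
    set 'rV[R]_n :=
  [set w | Num.sqrt (dotp (w - c) (w - c)) <= r].

Section hadamard.
Variables (R : realType) (n : nat).
Implicit Types (phi : 'rV[R]_n -> R) (x g : 'rV[R]_n).

Definition hadamard_quotient phi x (p : R * 'rV[R]_n) : R :=
  (phi (x + p.1 *: p.2) - phi x) / p.1.

(* [alpha, g'] -> [+0, g]: alpha tends to 0 through positive values, while g'
   tends to g and may be equal to g. *)
Definition hadamard_filter g : set_system (R * 'rV[R]_n) :=
  filter_prod 0^'+ (nbhs g).

Definition hadamard_differentiable_at phi x : Prop :=
  forall g, cvg (hadamard_quotient phi x @ hadamard_filter g).

Definition hadamard_deriv phi x g : R :=
  lim (hadamard_quotient phi x @ hadamard_filter g).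

Definition is_max (A : set R) (m : R) : Prop := A m /\ ubound A m.
Definition is_min (A : set R) (m : R) : Prop := A m /\ lbound A m.

Definition totally_bounded_family (E : set (set 'rV[R]_n)) : Prop :=
  exists (c : 'rV[R]_n) (r : R), forall C, E C -> C `<=` euclidean_ball c r.

Definition lower_exhauster phi x (E : set (set 'rV[R]_n)) : Prop :=
  [/\ forall C : set 'rV[R]_n,
        E C -> [/\ C !=set0, convex_set (C : set (convex_lmodType _)) & compact C],
      totally_bounded_family E
    & forall g, is_max
        [set m | exists2 C, E C & is_min [set dotp w g | w in C] m]
        (hadamard_deriv phi x g)].

(* All finite nonnegative combinations of points of C, so 0 is included. *)
Definition conic_hull (C : set 'rV[R]_n) : set 'rV[R]_n :=
  [set v | exists (k : nat) (a : 'I_k -> R) (w : 'I_k -> 'rV[R]_n),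
     [/\ forall i, 0 <= a i, forall i, C (w i) & v = \sum_(i < k) a i *: w i]].

Definition conjugate_cone (K : set 'rV[R]_n) : set 'rV[R]_n :=
  [set g | forall v, K v -> 0 <= dotp v g].

Definition Kplus (C : set 'rV[R]_n) : set 'rV[R]_n :=
  conjugate_cone (conic_hull C).

Definition Klt (u : 'rV[R]_n -> R) x : set 'rV[R]_n :=
  [set g | hadamard_deriv u x g < 0].

Definition Kle (u : 'rV[R]_n -> R) x : set 'rV[R]_n :=
  [set g | hadamard_deriv u x g <= 0].

Definition local_minimum_on (f : 'rV[R]_n -> R) (Omega : set 'rV[R]_n) x : Prop :=
  Omega x /\ \forall y \near within Omega (nbhs x), f x <= f y.

End hadamard.

(* Main.v *)
(* A point g of the left-hand side lies in the interior of no K^+(C), C in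
   E_*(u); as C is bounded, this forces min_{w in C} <w, g> <= 0, hence
   u'_H(x, g) <= 0, and by regularity g is a limit of directions g' with
   u'_H(x, g') < 0.  The Hadamard limit of f is uniform in directions near g,
   so f'_H(x, g) < 0 would give a g' along which both f and u decrease
   strictly, against local minimality.  Hence f'_H(x, g) >= 0, and the C in
   E_*(f) attaining it satisfies g in K^+(C). *)
Require Import Defs.
From HB Require Import structures.
From mathcomp Require Import all_boot all_order all_algebra.
From mathcomp Require Import all_classical all_reals all_analysis.

Set Implicit Arguments.
Unset Strict Implicit.
Unset Printing Implicit Defensive.

Import Order.TTheory GRing.Theory Num.Theory.
Import numFieldNormedType.Exports.

Local Open Scope classical_set_scope.
Local Open Scope ring_scope.

Lemma dotp_suml (R : realType) (n k : nat) (a : 'I_k -> R)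
    (w : 'I_k -> 'rV[R]_n) (g : 'rV[R]_n) :
  dotp (\sum_(i < k) a i *: w i) g = \sum_(i < k) a i * dotp (w i) g.
Proof.
rewrite /dotp; under [RHS]eq_bigr do rewrite big_distrr.
rewrite exchange_big; apply: eq_bigr => j _ /=.
rewrite summxE big_distrl; apply: eq_bigr => i _ /=.
by rewrite mxE mulrA.
Qed.

Lemma dotpBr (R : realType) (n : nat) (v w g : 'rV[R]_n) :
  dotp v (w - g) = dotp v w - dotp v g.
Proof.
rewrite /dotp -sumrB; apply: eq_bigr => i _.
by rewrite !mxE mulrBr.
Qed.

(** The norm here is the sup norm, so each of the [n] coordinate products is bounded by the product
    of the norms; hence the factor [n], absent from Cauchy-Schwarz. *)
Lemma normr_dotp_le (R : realType) (n : nat) (v w : 'rV[R]_n) :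
  `|dotp v w| <= n%:R * (`|v| * `|w|).
Proof.
have coord_le (x : 'rV[R]_n) i : `|x 0 i| <= `|x|.
  rewrite [leRHS]mx_normrE; exact: (le_bigmax _ _ (0, i)).
apply: le_trans (ler_norm_sum _ _ _) _.
rewrite mulr_natl -[X in _ *+ X](card_ord n) -sumr_const.
by apply: ler_sum => i _; rewrite normrM ler_pM.
Qed.

Lemma KplusP (R : realType) (n : nat) (C : set 'rV[R]_n) (g : 'rV[R]_n) :
  Kplus C g <-> forall w, C w -> 0 <= dotp w g.
Proof.
split=> [Cg w Cw|Cg v [k [a [w [a_ge0 Cw ->]]]]].
  apply: Cg; exists 1, (fun=> 1), (fun=> w); split=> //.
  by rewrite big_ord_recl big_ord0 addr0 scale1r.
by rewrite dotp_suml sumr_ge0 // => i _; rewrite mulr_ge0 ?Cg.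
Qed.

(** As [C] is bounded, a small move of [g] changes all the values [dotp w g], [w] in [C], by at most
    [m] at once. *)
Lemma near_Kplus (R : realType) (n : nat) (C : set 'rV[R]_n) (g : 'rV[R]_n)
    (m : R) :
  bounded_set C -> 0 < m -> (forall w, C w -> m <= dotp w g) ->
  \forall g' \near g, Kplus C g'.
Proof.
move=> [M0 [_ M0C]] m_gt0 mC.
(* [bounded_set] gives a norm bound only for reals strictly above [M0]; the absolute value also
   makes [M] positive. *)
pose M := `|M0| + 1.
have M_gt0 : 0 < M by rewrite ltr_wpDl.
have CM w : C w -> `|w| <= M.
  by apply: M0C; rewrite (le_lt_trans (ler_norm _)) ?ltrDl.
(* [n.+1] rather than [n] keeps the divisor positive when [n] is 0. *)
have c_gt0 : 0 < n.+1%:R * M by rewrite mulr_gt0.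
have r_gt0 : 0 < m / (n.+1%:R * M) by rewrite divr_gt0.
near=> g'; apply/KplusP => w Cw.
have gg' : `|g - g'| <= m / (n.+1%:R * M).
  by near: g'; apply: cvgr_dist_le => //; exact: cvg_id.
have : dotp w (g - g') <= m.
  apply: le_trans (ler_norm _) _; apply: le_trans (normr_dotp_le _ _) _.
  rewrite ler_pdivlMr // in gg'; apply: le_trans gg'.
  rewrite mulrA mulrC ler_wpM2l // ler_pM ?ler_nat ?CM //.
by rewrite dotpBr lerBlDr -lerBlDl; apply: le_trans; rewrite subr_ge0 mC.
Unshelve. all: by end_near. Qed.

(** The quotient is eventually negative and its denominator positive. Filtering on pairs gives the
    decrease for all directions near [g] simultaneously. *)
Lemma hadamard_deriv_lt0 (R : realType) (n : nat) (phi : 'rV[R]_n -> R)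
    (x g : 'rV[R]_n) :
  hadamard_differentiable_at phi x -> hadamard_deriv phi x g < 0 ->
  \forall p \near hadamard_filter g, phi (x + p.1 *: p.2) < phi x.
Proof.
move=> phix phig_lt0.
have lt0 : \forall p \near hadamard_filter g, hadamard_quotient phi x p < 0.
  exact: cvgr_lt (phix g) _ phig_lt0.
have gt0 : \forall p \near hadamard_filter g, 0 < p.1.
  exists ([set a | 0 < a], setT) => [|[a h] []//].
  by split; [exact: nbhs_right_gt|exact: filterT].
apply: filterS2 lt0 gt0 => p + p_gt0.
by rewrite /hadamard_quotient pmulr_llt0 ?invr_gt0 // subr_lt0.
Qed.

Lemma hadamard_deriv_ge0_closure_Klt (R : realType) (n : nat)
    (f u : 'rV[R]_n -> R) (x g : 'rV[R]_n) :
  hadamard_differentiable_at f x -> hadamard_differentiable_at u x ->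
  local_minimum_on f [set y | u y <= 0] x -> closure (Klt u x) g ->
  0 <= hadamard_deriv f x g.
Proof.
move=> fx ux [ux_le0 xmin] clg; rewrite leNgt; apply/negP => fg_lt0.
have [[A B] /= [A0 Bg] ABf] := hadamard_deriv_lt0 fx fg_lt0.
(* [B] does not depend on the step size, so [g'] can be fixed before [a] is chosen. *)
have [g' [ug'_lt0 Bg']] := clg _ Bg.
have [[A' B'] /= [A'0 B'g'] ABu] := hadamard_deriv_lt0 ux ug'_lt0.
have ray : x + a *: g' @[a --> 0^'+] --> x.
  apply: cvg_at_right_filter.
  rewrite -[X in _ --> X]addr0 -[X in _ + X](scale0r g').
  by apply: cvgD; [exact: cvg_cst|apply: cvgZr_tmp; exact: cvg_id].
(* The filter of right neighbourhoods of 0 is proper, so a single small [a] meeting all the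
   conditions yields the contradiction. *)
suff : \forall a \near (0 : R)^'+, False by move/filter_ex => -[].
near=> a.
have Aa : A a by near: a.
have A'a : A' a by near: a.
have /= f_lt := ABf (a, g') (conj Aa Bg').
have /= u_lt := ABu (a, g') (conj A'a (nbhs_singleton B'g')).
have : u (x + a *: g') <= 0 -> f x <= f (x + a *: g').
  by near: a; apply: ray xmin.
(* Feasibility follows from [u] decreasing below [u x <= 0], whether or not the constraint is active
   at [x]. *)
by move=> /(_ (le_trans (ltW u_lt) ux_le0)); rewrite leNgt f_lt.
Unshelve. all: by end_near. Qed.

Theorem theorem9 (R : realType) (n : nat) (f u : 'rV[R]_n -> R)
    (hf : forall x : 'rV[R]_n, hadamard_differentiable_at f x)
    (hu : forall x : 'rV[R]_n, hadamard_differentiable_at u x)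
    (Omega : set 'rV[R]_n) (hOmega : Omega = [set x | u x <= 0])
    (xs : 'rV[R]_n) (hxs : Omega xs)
    (hreg : closure (Klt u xs) = Kle u xs)
    (Ef Eu : set (set 'rV[R]_n))
    (hEf : lower_exhauster f xs Ef) (hEu : lower_exhauster u xs Eu)
    (hmin : local_minimum_on f Omega xs) :
  \bigcap_(C in Eu) closure (~` Kplus C) `<=` \bigcup_(C in Ef) Kplus C.
Proof.
subst Omega => g hg.
have [_ _ /(_ g)[[C EuC [[w Cw wE] wmin]] _]] := hEu.
have Kle_g : Kle u xs g.
  rewrite /Kle /= leNgt; apply/negP => ug_gt0.
  have [CEu _ _] := hEu; have [_ _ Ccompact] := CEu _ EuC.
  have near_g : \forall g' \near g, Kplus C g'.
    (* The uniform lower bound on [C] is [hadamard_deriv u xs g] itself, the minimum attained on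
       [C]. *)
    apply: near_Kplus (compact_bounded Ccompact) ug_gt0 _ => v Cv.
    by apply: wmin; exists v.
  (* This neighbourhood of [g] would have to meet the complement of [Kplus C]. *)
  by have [g' []] := hg C EuC _ near_g.
rewrite -hreg in Kle_g.
have fg_ge0 := hadamard_deriv_ge0_closure_Klt (hf xs) (hu xs) hmin Kle_g.
have [_ _ /(_ g)[[D EfD [_ Dmin]] _]] := hEf.
exists D => //; apply/KplusP => v Dv.
by apply: le_trans fg_ge0 _; apply: Dmin; exists v.
Qed.
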